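(* Let $\mathbb{K}$ be a field, $R=\mathbb{K}[x_1,x_2,x_3]$, and let $\phi:\{1,2,3\}\to\mathbb{N}$ be a linear degree function. If $\operatorname{char}(\mathbb{K})=0$ or $\operatorname{char}(\mathbb{K})>\phi(1)+\phi(2)+\phi(3)-2$, then the Hilbert series of $R/J_\phi$ is $$P(R/J_\phi,t)=\frac{1-3t^{\phi(1)}-3t^{2\phi(2)}-t^{3\phi(3)}+6t^{\phi(1)+\phi(2)}+6t^{2\phi(2)+\phi(3)}-6t^{\phi(1)+\phi(2)+\phi(3)}}{(1-t)^3}.$$
   Context: $\mathbb{N}$ denotes the positive integers. A function $\phi:\{1,2,3\}\to\mathbb{N}$ is a linear degree function if there are $k,l\in\mathbb{N}$ with $\phi(r)=l+k(3-r)$, i.e. $\phi(1)=l+2k$, $\phi(2)=l+k$, $\phi(3)=l$. The ideal $J_\phi\subseteq R=\mathbb{K}[x_1,x_2,x_3]$ is $$J_\phi=\langle x_1^{\phi(1)},x_2^{\phi(1)},x_3^{\phi(1)},(x_1+x_2)^{2\phi(2)},(x_1+x_3)^{2\phi(2)},(x_2+x_3)^{2\phi(2)},(x_1+x_2+x_3)^{3\phi(3)}\rangle.$$ For a homogeneous ideal $I\subseteq R$ (standard grading), $P(R/I,t)=\sum_{j\ge 0}\dim_{\mathbb{K}}(R/I)_j\,t^j$. *)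

(* Defs.v *)
From HB Require Import structures.
From mathcomp Require Import all_boot all_order all_algebra.
From mathcomp Require Import generic_quotient ring_quotient.
From mathcomp.multinomials Require Import mpoly.
(* boolp is not imported: its dependencies clash with the mpoly notations. *)
From mathcomp Require boolp.

Set Implicit Arguments.
Unset Strict Implicit.
Unset Printing Implicit Defensive.

Import GRing.Theory.
Local Open Scope ring_scope.
Local Open Scope quotient_scope.

Section IdealQuotient.
Variables (K : fieldType) (n : nat).
Implicit Types gs : seq {mpoly K[n]}.

Definition in_ideal gs (p : {mpoly K[n]}) : Prop :=
  exists c : nat -> {mpoly K[n]}, p = \sum_(i < size gs) c i * gs`_i.

(* [Quotient.quot] needs a boolean predicate, hence the classical [asbool];
   it only needs closure under subtraction, so the ideal may be improper. *)
Definition ideal gs : {pred {mpoly K[n]}} :=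
  fun p => boolp.asbool (in_ideal gs p).

Lemma idealP gs p : reflect (in_ideal gs p) (p \in ideal gs).
Proof. exact: boolp.asboolP. Qed.

Lemma ideal_zmod_closed gs : zmod_closed (ideal gs).
Proof.
split; first by apply/idealP; exists (fun=> 0); rewrite big1 // => i _; rewrite mul0r.
move=> p q /idealP[c ->] /idealP[d ->]; apply/idealP; exists (fun i => c i - d i).
by rewrite -sumrB; apply: eq_bigr => i _; rewrite mulrBl.
Qed.

HB.instance Definition _ gs :=
  GRing.isZmodClosed.Build {mpoly K[n]} (ideal gs) (ideal_zmod_closed gs).

Lemma idealMl gs p q : q \in ideal gs -> p * q \in ideal gs.
Proof.
move=> /idealP[c ->]; apply/idealP; exists (fun i => p * c i).
by rewrite mulr_sumr; apply: eq_bigr => i _; rewrite mulrA.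
Qed.

Lemma idealZ gs (a : K) q : q \in ideal gs -> a *: q \in ideal gs.
Proof. by move=> Iq; rewrite -mul_mpolyC idealMl. Qed.

Definition mquot gs := Quotient.quot (ideal gs).
HB.instance Definition _ gs := GRing.Zmodule.on (mquot gs).

Definition mproj gs (p : {mpoly K[n]}) : mquot gs :=
  \pi_(Quotient.quot (ideal gs)) p.

Lemma mprojP gs p q : reflect (mproj gs p = mproj gs q) (p - q \in ideal gs).
Proof. by rewrite Quotient.idealrBE; apply: eqP. Qed.

Lemma mproj_surj gs (x : mquot gs) : mproj gs (repr x) = x.
Proof. exact: reprK. Qed.

Lemma mprojD gs p q : mproj gs (p + q) = mproj gs p + mproj gs q.
Proof. exact: Quotient.pi_add. Qed.

Definition mquot_scale gs (a : K) (x : mquot gs) : mquot gs :=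
  mproj gs (a *: repr x).

Lemma mquot_scaleE gs a p : mquot_scale a (mproj gs p) = mproj gs (a *: p).
Proof.
apply/mprojP; rewrite -scalerBr; apply/idealZ/mprojP; exact: mproj_surj.
Qed.

Lemma mquot_scaleA gs a b (x : mquot gs) :
  mquot_scale a (mquot_scale b x) = mquot_scale (a * b) x.
Proof. by rewrite -(mproj_surj x) !mquot_scaleE scalerA. Qed.

Lemma mquot_scale1 gs : left_id 1 (@mquot_scale gs).
Proof. by move=> x; rewrite -(mproj_surj x) mquot_scaleE scale1r. Qed.

Lemma mquot_scaleDr gs : right_distributive (@mquot_scale gs) +%R.
Proof.
move=> a x y; rewrite -(mproj_surj x) -(mproj_surj y) -mprojD !mquot_scaleE.
by rewrite scalerDr mprojD.
Qed.

Lemma mquot_scaleDl gs (x : mquot gs) :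
  {morph (@mquot_scale gs)^~ x : a b / a + b}.
Proof.
by move=> a b; rewrite /= -(mproj_surj x) !mquot_scaleE scalerDl mprojD.
Qed.

HB.instance Definition _ gs := GRing.Zmodule_isLmodule.Build K (mquot gs)
  (@mquot_scaleA gs) (@mquot_scale1 gs) (@mquot_scaleDr gs)
  (@mquot_scaleDl gs).

Lemma mproj_is_linear gs : linear (mproj gs).
Proof. by move=> a p q; rewrite mprojD -mquot_scaleE. Qed.

HB.instance Definition _ gs := GRing.isLinear.Build K {mpoly K[n]} (mquot gs)
  _ (mproj gs) (mproj_is_linear gs).

(* (R/I)_j is the image of R_j; this is a grading of R/I when I is homogeneous. *)
Definition graded_piece gs (j : nat) (x : mquot gs) : Prop :=
  exists2 p : {mpoly K[n]}, p \is j.-homog & x = mproj gs p.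

End IdealQuotient.

(* Only meant for S a linear subspace of V. *)
Definition has_dim (K : fieldType) (V : lmodType K) (S : V -> Prop) (d : nat) :=
  exists b : 'I_d -> V,
    [/\ forall i, S (b i),
        forall a : 'I_d -> K, \sum_(i < d) a i *: b i = 0 -> forall i, a i = 0
      & forall x, S x -> exists a : 'I_d -> K, x = \sum_(i < d) a i *: b i].

(* Formal power series over int are represented by their coefficients. *)
Definition fps := nat -> int.

Definition is_hilbert_series (K : fieldType) (n : nat)
    (gs : seq {mpoly K[n]}) (P : fps) : Prop :=
  forall j, exists2 d : nat, has_dim (@graded_piece K n gs j) d & P j = d%:Z.

Definition fps_mul (P Q : fps) : fps :=
  fun m => \sum_(i < m.+1) P i * Q (m - i)%N.

Definition fps_of_poly (p : {poly int}) : fps := fun m => p`_m.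

(* P = N / D in int[[t]]: when D(0) is a unit, D is invertible in int[[t]] and
   the product equation determines P. *)
Definition fps_is_fraction (P : fps) (N D : {poly int}) : Prop :=
  D`_0 \is a GRing.unit /\ fps_mul P (fps_of_poly D) =1 fps_of_poly N.

(* A function on {1,2,3} is represented by a function on nat of which only the
   values at 1, 2 and 3 matter. *)
Definition linear_degree_function (phi : nat -> nat) : Prop :=
  exists k l : nat, [/\ (0 < k)%N, (0 < l)%N
    & forall r, (1 <= r <= 3)%N -> phi r = (l + k * (3 - r))%N].

Definition J_gens (K : fieldType) (phi : nat -> nat) : seq {mpoly K[3]} :=
  let x1 := 'X_(inord 0%N) in
  let x2 := 'X_(inord 1%N) in
  let x3 := 'X_(inord 2%N) in
  [:: x1 ^+ (phi 1%N); x2 ^+ (phi 1%N); x3 ^+ (phi 1%N);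
      (x1 + x2) ^+ (2 * phi 2)%N; (x1 + x3) ^+ (2 * phi 2)%N;
      (x2 + x3) ^+ (2 * phi 2)%N; (x1 + x2 + x3) ^+ (3 * phi 3)%N].

(* Main.v *)
Require Import Defs.
From HB Require Import structures.
From mathcomp Require Import all_boot all_order all_algebra.
From mathcomp Require Import ring zify.
From mathcomp.multinomials Require Import mpoly.

Set Implicit Arguments.
Unset Strict Implicit.
Unset Printing Implicit Defensive.

Import GRing.Theory.
Local Open Scope ring_scope.

(** Give the vertices 0, 1, 2, 3 the following edges: l parallel ones from 0
    to each other vertex, and k parallel ones between any two of 1, 2, 3.
    Every edge uv is a vector e_u - e_v (with e_0 = 0), and for a nonempty
    subset S of {1, 2, 3} the linear form x_S, the sum of the x_i for i in S,
    fails to be orthogonal to exactly the edges of the cut between S and its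
    complement.  Their number is phi(1), 2 phi(2) or 3 phi(3) according to the
    size of S, so J_phi is the power ideal generated by x_S ^ (number of edges
    in the cut of S): the central power ideal of zonotopal algebra.

    Such ideals obey a deletion-contraction rule.  For a list X of edges and a
    list C of contracted edges, let W_C be the ring of polynomials killed by
    all derivatives D_y, y in C, and let J(C, X) be the ideal of W_C generated
    by the h ^ m_X(h), where h runs over the forms x_S orthogonal to C and
    m_X(h) counts the x in X that are not orthogonal to h.  When x lies
    outside the span of C, the derivative D_x fits, in the degrees where
    integration is possible, into an exact sequence
      0 -> W_(x :: C) / J(x :: C, X) -> W_C / J(C, x :: X)
        -> W_C / J(C, X) (-1) -> 0.

    Upper bound: the elements of J(C, X) have antiderivatives in
    J(C, x :: X), by integration by parts ([integrate_power_ideal]), so an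
    element whose derivative is in J(C, X) is congruent to one in the kernel
    W_(x :: C) of D_x ([spans_step]).  Integration divides by the integers up
    to the degree involved, whence the restriction on the characteristic.

    Lower bound: a product of derivatives D_y, with y in a sublist Y of X,
    followed by evaluation at 0, kills J(C, X) as soon as m_Y(h) < m_X(h) for
    every generator h ([ev_mulXn]).  Along the recursion these functionals are
    either extended from W_(x :: C) to W_C unchanged, or composed with D_x,
    and both operations together preserve linear independence
    ([separates_step]).

    The two bounds agree, which determines the Hilbert function up to any
    degree N such that 1, ..., N are invertible in the field
    ([hilbert_step]).  Unfolding the recursion on the graph above gives a
    polynomial that, multiplied by (1 - t)^3, is the announced numerator
    ([cut_ideal_hilbert]).  Its degree is below N = phi(1) + phi(2) + phi(3) -
    2, so the ideal contains all forms of degree N, hence all forms of larger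
    degree, where no hypothesis on the characteristic is available. *)

(** * Directional derivatives *)

Section Derivations.
Variables (K : fieldType) (n : nat).
Local Notation R := {mpoly K[n]}.
Local Notation V := 'rV[K]_n.
Implicit Types (x y h w : V) (f g : R) (C X Y : seq V).

Definition dot x h : K := \sum_(i < n) x 0 i * h 0 i.
Definition dirD x f : R := \sum_(i < n) x 0 i *: f^`M(i).
Definition linf h : R := \sum_(i < n) h 0 i *: 'X_i.

Lemma dirD_is_linear x : linear (dirD x).
Proof.
move=> a f g; rewrite /dirD scaler_sumr -big_split; apply: eq_bigr => i _ /=.
by rewrite mderivD mderivZ scalerDr !scalerA mulrC.
Qed.

HB.instance Definition _ x :=
  GRing.isLinear.Build K R R _ (dirD x) (dirD_is_linear x).

Lemma dirDM x f g : dirD x (f * g) = dirD x f * g + f * dirD x g.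
Proof.
rewrite /dirD mulr_suml mulr_sumr -big_split; apply: eq_bigr => i _ /=.
by rewrite mderivM scalerDr scalerAl scalerAr.
Qed.

Lemma mderiv_linf i h : (linf h)^`M(i) = (h 0 i)%:MP.
Proof.
transitivity (\sum_(j < n) (h 0 j * (j == i)%:R)%:MP_[n]).
  rewrite /linf (raddf_sum (mderiv i)); apply: eq_bigr => j _ /=.
  rewrite mderivZ mderivX mnm1E; have [->|_] := eqVneq j i; last first.
    by rewrite scale0r scaler0 mulr0 mpolyC0.
  by rewrite -[X in (X - _)%MM]add0m addmK mpolyX0 scale1r mulr1 alg_mpolyC.
rewrite -raddf_sum (bigD1 i) //= big1 ?addr0 ?eqxx ?mulr1 // => j /negbTE->.
by rewrite mulr0.
Qed.

Lemma dirD_linf x h : dirD x (linf h) = (dot x h)%:MP.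
Proof.
rewrite /dot [RHS]raddf_sum; apply: eq_bigr => i _ /=.
by rewrite mderiv_linf mpolyCM mul_mpolyC.
Qed.

Lemma dirD_mderiv x i f : dirD x f^`M(i) = (dirD x f)^`M(i).
Proof.
rewrite [in RHS]/dirD (raddf_sum (mderiv i)); apply: eq_bigr => j _ /=.
by rewrite mderivZ mderiv_comm.
Qed.

Lemma dirDC x y f : dirD x (dirD y f) = dirD y (dirD x f).
Proof.
rewrite [dirD y f]/dirD (raddf_sum (dirD x)); apply: eq_bigr => i _ /=.
by rewrite linearZ /= dirD_mderiv.
Qed.

Lemma dirDXn x f m : dirD x (f ^+ m.+1) = m.+1%:R *: (f ^+ m * dirD x f).
Proof.
elim: m => [|m IH]; first by rewrite expr1 expr0 mul1r scale1r.
rewrite exprS dirDM IH -scalerAr mulrA -exprS (mulrC (dirD x f)).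
by rewrite -{1}[_ * dirD x f]scale1r -scalerDl -mulrS.
Qed.

Lemma mderiv_homog j i f : f \is j.+1.-homog -> f^`M(i) \is j.-homog.
Proof.
move=> /dhomogP Hf; apply/dhomogP => m.
rewrite mcoeff_msupp mcoeff_deriv.
have := Hf (m + U_(i))%MM; rewrite mcoeff_msupp /= mdegD mdeg1 addn1.
by have [->|_ /(_ isT) []//] := eqVneq; rewrite mul0rn eqxx.
Qed.

Lemma dirD_homog j x f : f \is j.+1.-homog -> dirD x f \is j.-homog.
Proof. by move=> Hf; apply: rpred_sum => i _; apply/rpredZ/mderiv_homog. Qed.

Lemma dirD_homog0 x f : f \is 0.-homog -> dirD x f = 0.
Proof.
move=> /dhomogP Hf; rewrite /dirD big1 // => i _.
suff -> : f^`M(i) = 0 by rewrite scaler0.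
apply/mpolyP => m; rewrite mcoeff_deriv mcoeff0.
have := Hf (m + U_(i))%MM; rewrite mcoeff_msupp /= mdegD mdeg1 addn1.
by have [->|_ /(_ isT)//] := eqVneq; rewrite mul0rn.
Qed.

Lemma linf_homog h : linf h \is 1.-homog.
Proof. by apply: rpred_sum => i _; rewrite rpredZ // dhomogX /= mdeg1. Qed.

Lemma mdegS_gt0 (m : 'X_{1..n}) j : mdeg m = j.+1 -> exists i, (0 < m i)%N.
Proof.
move=> m_j; suff /existsP[i mi] : [exists i, 0 < m i]%N by exists i.
apply: contraT => /existsPn m0.
suff m00 : m = 0%MM by rewrite m00 mdeg0 in m_j.
by apply/mnmP => i; have := m0 i; rewrite mnm0E; case: (m i).
Qed.

Definition ker C f := all (fun y => dirD y f == 0) C.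
Definition perp C h := all (fun y => dot y h == 0) C.
Definition mult X h := count (fun x => dot x h != 0) X.

Lemma kerP C f : reflect {in C, forall y, dirD y f = 0} (ker C f).
Proof. by apply: (iffP allP) => Cf y /Cf /eqP. Qed.

Lemma ker_cons x C f : ker (x :: C) f = (dirD x f == 0) && ker C f.
Proof. by []. Qed.

Lemma ker0 C : ker C 0.
Proof. by apply/kerP => y _; rewrite raddf0. Qed.

Lemma kerD C f g : ker C f -> ker C g -> ker C (f + g).
Proof.
move=> /kerP Hf /kerP Hg; apply/kerP => y yC.
by rewrite raddfD /= Hf // Hg // addr0.
Qed.

Lemma kerZ C a f : ker C f -> ker C (a *: f).
Proof.
by move=> /kerP Hf; apply/kerP => y yC; rewrite linearZ /= Hf // scaler0.
Qed.

Lemma kerB C f g : ker C f -> ker C g -> ker C (f - g).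
Proof. by move=> Hf Hg; rewrite -scaleN1r kerD // kerZ. Qed.

Lemma ker_sum C I (r : seq I) (P : pred I) (F : I -> R) :
  (forall i, P i -> ker C (F i)) -> ker C (\sum_(i <- r | P i) F i).
Proof.
move=> HF; apply: (big_ind (ker C)) => [|f g|i].
- exact: ker0.
- exact: kerD.
- exact: HF.
Qed.

Lemma kerM C f g : ker C f -> ker C g -> ker C (f * g).
Proof.
move=> /kerP Hf /kerP Hg; apply/kerP => y yC.
by rewrite dirDM Hf // Hg // mul0r mulr0 addr0.
Qed.

Lemma ker_linf C h : perp C h -> ker C (linf h).
Proof.
by move=> /allP Ch; apply/kerP => y /Ch /eqP yh; rewrite dirD_linf yh mpolyC0.
Qed.

Lemma ker_homog0 C f : f \is 0.-homog -> ker C f.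
Proof. by move=> f0; apply/kerP => y _; rewrite dirD_homog0. Qed.

Lemma kerXn C f m : ker C f -> ker C (f ^+ m).
Proof.
move=> Hf; elim: m => [|m IH]; last by rewrite exprS; apply: kerM.
by rewrite expr0 ker_homog0 // dhomog1.
Qed.

Lemma ker_dirD C x f : ker C f -> ker C (dirD x f).
Proof.
by move=> /kerP Hf; apply/kerP => y yC; rewrite dirDC Hf // raddf0.
Qed.

Lemma mult_cons X x h :
  mult (x :: X) h = ((dot x h != 0%R) + mult X h)%N.
Proof. by []. Qed.

Definition derivs Y f := foldl (fun g x => dirD x g) f Y.
Definition ev Y f : K := (derivs Y f)@_0%MM.

Lemma derivs_is_linear Y : linear (derivs Y).
Proof. by elim: Y => [|x Y IH] a f g //=; rewrite /= linearP IH. Qed.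

HB.instance Definition _ Y :=
  GRing.isLinear.Build K R R _ (derivs Y) (derivs_is_linear Y).

Lemma ev_is_linear Y : linear_for *%R (ev Y).
Proof. by move=> a f g; rewrite /ev linearP mcoeffD mcoeffZ. Qed.

HB.instance Definition _ Y :=
  GRing.isLinear.Build K R K _ (ev Y) (ev_is_linear Y).

Lemma ev_lincomb Y (I : finType) (a : I -> K) (s : I -> R) :
  ev Y (\sum_i a i *: s i) = \sum_i a i * ev Y (s i).
Proof. by rewrite linear_sum; apply: eq_bigr => i _; rewrite linearZ. Qed.

(** By the Leibniz rule, only the derivatives in directions that are not
    orthogonal to h lower the power of h, each of them by at most one. *)
Lemma derivs_mulXn Y h m g : exists g',
  derivs Y (g * linf h ^+ m) = g' * linf h ^+ (m - mult Y h).
Proof.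
elim: Y m g => [|x Y IH] m g; first by exists g; rewrite subn0.
rewrite mult_cons /= dirDM; have [xh0|nxh] := eqVneq (dot x h) 0.
  have -> : dirD x (linf h ^+ m) = 0.
    case: m => [|m]; first by rewrite expr0 dirD_homog0 ?dhomog1.
    by rewrite dirDXn dirD_linf xh0 mpolyC0 mulr0 scaler0.
  by rewrite mulr0 addr0 add0n; apply: IH.
case: m => [|m].
  by eexists; rewrite sub0n [in RHS]expr0 mulr1.
rewrite dirDXn dirD_linf exprS mulrA add1n subSS.
have -> : dirD x g * linf h * linf h ^+ m
    + g * (m.+1%:R *: (linf h ^+ m * (dot x h)%:MP))
  = (dirD x g * linf h + (m.+1%:R * dot x h) *: g) * linf h ^+ m.
  by rewrite mulrDl (mulrC _ _%:MP) mul_mpolyC scalerA -scalerAl -scalerAr.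
exact: IH.
Qed.

Lemma ev_mulXn Y h m g : (mult Y h < m)%N -> ev Y (g * linf h ^+ m) = 0.
Proof.
move=> lt; rewrite /ev; have [g' ->] := derivs_mulXn Y h m g.
have -> : (m - mult Y h = (m - mult Y h).-1.+1)%N by rewrite prednK ?subn_gt0.
rewrite rmorphM rmorphXn /= exprS.
have -> : (linf h)@_0 = 0.
  rewrite /linf (raddf_sum (mcoeff 0%MM)) big1 // => i _ /=.
  by rewrite mcoeffZ mcoeffX mnm1_eq0 mulr0.
by rewrite mul0r mulr0.
Qed.

End Derivations.

(* Keeps [mult (x :: X) h] folded under [simpl], for rewriting with equations
   on multiplicities. *)
Arguments mult : simpl never.

(** * Power ideals and their antiderivatives *)

Section DeletionContraction.
Variables (K : fieldType) (n : nat) (N : nat) (hs : seq 'rV[K]_n).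
Local Notation R := {mpoly K[n]}.
Local Notation V := 'rV[K]_n.
Implicit Types (x y h w : V) (f g : R) (C X Y : seq V) (j d e m : nat).

(** The degree j part of the ideal J(C, X) of the ring W_C; the cofactors are
    taken in W_C and homogeneous so that they can be integrated within W_C and
    with a bound on the integers to be inverted. *)
Inductive power_ideal C X j : R -> Prop :=
| power_ideal0 : power_ideal C X j 0
| power_idealD h e f g :
    h \in hs -> perp C h -> (e + mult X h)%N = j ->
    ker C g -> g \is e.-homog -> power_ideal C X j f ->
    power_ideal C X j (g * linf h ^+ mult X h + f).

Lemma power_ideal_add C X j f g :
  power_ideal C X j f -> power_ideal C X j g -> power_ideal C X j (f + g).
Proof.
move=> If Ig; elim: If => [|h e f' g' hs_h Ch ej Cg g_e _ IH].
  by rewrite add0r.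
by rewrite -addrA; apply: power_idealD ej _ _ IH.
Qed.

Lemma power_ideal_ker_homog C X j f :
  power_ideal C X j f -> ker C f /\ f \is j.-homog.
Proof.
elim=> [|h e f' g hs_h Ch ej Cg g_e _ [Cf f_j]].
  by split; [exact: ker0 | exact: rpred0].
split; first by apply/kerD/Cf/kerM/kerXn/ker_linf/Ch.
rewrite rpredD // -ej; apply: dhomogM => //.
by have := dhomogMn (mult X h) (linf_homog h); rewrite mul1n.
Qed.

Lemma power_ideal_contract C X x j f :
  power_ideal (x :: C) X j f -> power_ideal C (x :: X) j f.
Proof.
elim=> [|h e f' g hs_h /= /andP[/eqP xh Ch] ej /andP[_ Cg] g_e _ IH].
  exact: power_ideal0.
have mE : mult X h = mult (x :: X) h by rewrite mult_cons xh eqxx.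
by rewrite mE; apply: power_idealD hs_h Ch _ Cg g_e IH; rewrite -mE.
Qed.

Lemma power_ideal_loop C X x j f : (forall h, perp C h -> dot x h = 0) ->
  power_ideal C X j f -> power_ideal C (x :: X) j f.
Proof.
move=> xloop; elim=> [|h e f' g hs_h Ch ej Cg g_e _ IH].
  exact: power_ideal0.
have mE : mult X h = mult (x :: X) h by rewrite mult_cons xloop // eqxx.
by rewrite mE; apply: power_idealD hs_h Ch _ Cg g_e IH; rewrite -mE.
Qed.

Hypothesis N_unit : forall i, (0 < i <= N)%N -> i%:R != 0 :> K.

(** Integration by parts: up to the factor (m + 1) D_x(h), an antiderivative
    of g h^m is g h^(m+1) minus an antiderivative of D_x(g) h^(m+1), and the
    degree of D_x(g) is smaller than that of g. *)
Lemma integrate_mulXn C x h e m g :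
    perp C h -> dot x h != 0 -> ker C g -> g \is e.-homog ->
    (e + m < N)%N ->
  exists G, [/\ ker C G, G \is e.-homog
    & dirD x (G * linf h ^+ m.+1) = g * linf h ^+ m].
Proof.
move=> Ch xh; elim: e m g => [|e IH] m g Cg g_e lt_N.
all: have nz : m.+1%:R * dot x h != 0.
1,3: by rewrite mulf_neq0 // N_unit //= (leq_trans _ lt_N) // ltnS leq_addl.
  exists ((m.+1%:R * dot x h)^-1 *: g); split; [exact: kerZ | exact: rpredZ|].
  rewrite -scalerAl linearZ /= dirDM dirD_homog0 // mul0r add0r.
  rewrite dirDXn dirD_linf (mulrC _ _%:MP) mul_mpolyC scalerA -scalerAr.
  by rewrite scalerA mulVf // scale1r.
have [|//||G' [CG' G'e DG']] := IH m.+1 (dirD x g).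
- exact: ker_dirD.
- exact: dirD_homog.
- by rewrite addnS -addSn.
exists ((m.+1%:R * dot x h)^-1 *: (g - G' * linf h)); split.
- by apply/kerZ/kerB => //; apply/kerM/ker_linf.
- apply/rpredZ/rpredB => //; rewrite -addn1; apply: dhomogM => //.
  exact: linf_homog.
rewrite -scalerAl linearZ /= mulrBl raddfB /= -mulrA -exprS DG' dirDM.
rewrite addrC addKr.
rewrite dirDXn dirD_linf (mulrC _ _%:MP) mul_mpolyC scalerA -scalerAr.
by rewrite scalerA mulVf // scale1r.
Qed.

Lemma integrate_homog C x w e g :
    perp C w -> dot x w != 0 -> ker C g -> g \is e.-homog -> (e < N)%N ->
  exists G, [/\ ker C G, G \is e.+1.-homog & dirD x G = g].
Proof.
move=> Cw xw Cg g_e lt_N.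
have [|G [CG Ge DG]] := integrate_mulXn (m := 0) Cw xw Cg g_e.
  by rewrite addn0.
exists (G * linf w); split; first by apply/kerM/ker_linf.
  by rewrite -addn1; apply/dhomogM/linf_homog.
by rewrite DG mulr1.
Qed.

(** The condition on w says that x is outside the span of C.  If h is not
    orthogonal to x, the exponent of h grows by one together with the degree,
    so that integration by parts against h applies; otherwise h is a constant
    for D_x and it is enough to integrate the cofactor. *)
Lemma integrate_power_ideal C X x w j f :
    perp C w -> dot x w != 0 -> (j < N)%N -> power_ideal C X j f ->
  exists2 F, power_ideal C (x :: X) j.+1 F & dirD x F = f.
Proof.
move=> Cw xw lt_N; elim=> [|h e f' g hs_h Ch ej Cg g_e _ [F IF DF]].
  by exists 0; [exact: power_ideal0 | rewrite raddf0].
have [xh|xh] := eqVneq (dot x h) 0.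
  have mE : mult X h = mult (x :: X) h by rewrite mult_cons xh eqxx.
  have [|G [CG Ge DG]] := integrate_homog Cw xw Cg g_e.
    by apply: leq_ltn_trans lt_N; rewrite -ej leq_addr.
  exists (G * linf h ^+ mult (x :: X) h + F).
    by apply: power_idealD CG Ge IF => //; rewrite addSn -mE ej.
  rewrite raddfD /= DF dirDM DG -mE; congr (_ + _).
  case: (mult X h) => [|k].
    by rewrite expr0 dirD_homog0 ?dhomog1 // mulr0 addr0.
  by rewrite dirDXn dirD_linf xh mpolyC0 mulr0 scaler0 mulr0 addr0.
have mE : mult (x :: X) h = (mult X h).+1 by rewrite mult_cons xh.
have [|G [CG Ge DG]] := integrate_mulXn (m := mult X h) Ch xh Cg g_e.
  by rewrite ej.
exists (G * linf h ^+ mult (x :: X) h + F).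
  by apply: power_idealD CG Ge IF => //; rewrite mE addnS ej.
by rewrite raddfD /= DF mE DG.
Qed.

(** * The upper bound *)

Definition spans C X j d := exists s : 'I_d -> R,
  (forall i, ker C (s i) /\ s i \is j.-homog) /\
  forall f, ker C f -> f \is j.-homog ->
    exists a : 'I_d -> K, power_ideal C X j (f - \sum_(i < d) a i *: s i).

Lemma big_split_fun (T : lmodType K) d1 d2 (a1 : 'I_d1 -> K) (a2 : 'I_d2 -> K)
    (b1 : 'I_d1 -> T) (b2 : 'I_d2 -> T) :
  \sum_(i < d1 + d2)
     (match split i with inl k => a1 k | inr k => a2 k end) *:
     (match split i with inl k => b1 k | inr k => b2 k end)
  = \sum_i a1 i *: b1 i + \sum_i a2 i *: b2 i.
Proof.
rewrite big_split_ord /=; congr (_ + _); apply: eq_bigr => i _.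
  by rewrite (unsplitK (inl i)).
by rewrite (unsplitK (inr i)).
Qed.

(** In degree 0 the derivative D_x is zero, and only the contraction
    contributes. *)
Lemma spans_step0 C X x d : spans (x :: C) X 0 d -> spans C (x :: X) 0 d.
Proof.
move=> [s [Hs Sp]]; exists s; split=> [i|f Cf f0].
  by have [/andP[]] := Hs i.
have [|a Ia] := Sp f _ f0; first by rewrite ker_cons dirD_homog0 ?eqxx.
by exists a; apply: power_ideal_contract.
Qed.

(** Exactness in the middle of the sequence: D_x(f) is congruent to a combination of
    the generators for (C, X); subtracting from f an antiderivative of that
    combination and one of the error leaves an element of W_(x :: C). *)
Lemma spans_step C X x w j d1 d2 :
    perp C w -> dot x w != 0 -> (j < N)%N ->
    spans (x :: C) X j.+1 d1 -> spans C X j d2 ->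
  spans C (x :: X) j.+1 (d1 + d2).
Proof.
move=> Cw xw lt_N [s [Hs Sp]] [t [Ht Tp]].
have /boolp.choice[T HT] i : exists G,
    [/\ ker C G, G \is j.+1.-homog & dirD x G = t i].
  by have [Cti ti_j] := Ht i; exact: integrate_homog Cw xw Cti ti_j lt_N.
exists (fun i => match split i with inl k => s k | inr k => T k end); split.
  move=> i; case: (split i) => k; last by have [] := HT k.
  by have [/andP[]] := Hs k.
move=> f Cf f_j.
have [b Ib] := Tp _ (ker_dirD x Cf) (dirD_homog x f_j).
have [F IF DF] := integrate_power_ideal Cw xw lt_N Ib.
have [CF F_j] := power_ideal_ker_homog IF.
pose f1 := f - \sum_i b i *: T i - F.
have Cf1 : ker (x :: C) f1.
  rewrite ker_cons; apply/andP; split; last first.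
    apply: kerB CF; apply: kerB => //; apply: ker_sum => i _; apply: kerZ.
    by have [] := HT i.
  have DT : dirD x (\sum_i b i *: T i) = \sum_i b i *: t i.
    rewrite (raddf_sum (dirD x)); apply: eq_bigr => i _.
    by have [_ _ <-] := HT i; rewrite -linearZ.
  by rewrite /f1 !raddfB /= DF DT subrr.
have f1_j : f1 \is j.+1.-homog.
  apply: rpredB F_j; apply: rpredB => //; apply: rpred_sum => i _.
  by apply: rpredZ; have [] := HT i.
have [a Ia] := Sp _ Cf1 f1_j.
exists (fun i => match split i with inl k => a k | inr k => b k end).
rewrite big_split_fun; have := power_ideal_add (power_ideal_contract Ia) IF.
by congr power_ideal; rewrite /f1; ring.
Qed.

Lemma spans_loop C X x j d : (forall h, perp C h -> dot x h = 0) ->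
  spans C X j d -> spans C (x :: X) j d.
Proof.
move=> xl [s [Hs Sp]]; exists s; split=> // f Cf f_j.
by have [a Ia] := Sp f Cf f_j; exists a; apply: power_ideal_loop.
Qed.

(** The generator h ^ 0 = 1 makes the ideal improper. *)
Lemma spans_deficient C X h j :
  h \in hs -> perp C h -> perp X h -> spans C X j 0.
Proof.
move=> hs_h Ch Xh; exists (fun _ => 0); split=> [[]//|f Cf f_j].
exists (fun _ => 0); rewrite big_ord0 subr0.
have m0 : mult X h = 0%N.
  apply/eqP; rewrite -leqn0 leqNgt -has_count -all_predC.
  by apply: sub_all Xh => y /=; rewrite negbK.
have := power_idealD (X := X) (j := j) hs_h Ch _ Cf f_j (power_ideal0 _ _ _).
by rewrite m0 expr0 mulr1 addr0; apply; rewrite addn0.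
Qed.

(** When C spans the whole space, W_C has no element of positive degree up to
    N: differentiating a monomial with a variable of exponent i multiplies its
    coefficient by i, which is invertible. *)
Lemma spans_base C X j : (j <= N)%N ->
    (forall i f, ker C f -> f^`M(i) = 0) -> spans C X j (j == 0)%N.
Proof.
move=> le_N Cfull; case: j => [|j] in le_N *.
  exists (fun _ => 1); split=> [_|f Cf f_0].
    by rewrite dhomog1 ker_homog0 // dhomog1.
  exists (fun _ => f@_0); rewrite big_ord1.
  suff -> : f - f@_0 *: 1 = 0 by exact: power_ideal0.
  rewrite alg_mpolyC; apply/eqP; rewrite subr_eq0; apply/eqP/mpolyP => m.
  rewrite mcoeffC; have [<-|ne_m] := eqVneq 0%MM m; first by rewrite mulr1.
  rewrite mulr0; apply: (dhomog_nemf_coeff f_0).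
  by rewrite mdeg_eq0 eq_sym.
exists (fun _ => 0); split=> [[]//|f Cf /dhomogP f_j].
exists (fun _ => 0); rewrite big_ord0 subr0.
suff -> : f = 0 by exact: power_ideal0.
apply/mpolyP => m; rewrite mcoeff0; apply/eqP/negP => /negP nz.
have := f_j m; rewrite mcoeff_msupp => /(_ nz) /= m_j.
have [i mi] := mdegS_gt0 m_j.
have le_m : (U_(i) <= m)%MM by rewrite lep1mP -lt0n.
have /(congr1 (mcoeff (m - U_(i))%MM)) := Cfull i f Cf.
rewrite mcoeff_deriv submK // mcoeff0 mnmBE mnm1E eqxx subn1 prednK //.
apply/eqP; rewrite -mulr_natr mulf_neq0 // N_unit // mi /=.
apply: leq_trans le_N; rewrite -m_j mdegE (bigD1 i) //=; exact: leq_addr.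
Qed.

(** * The lower bound *)

(** The second condition makes the functional [ev Y] vanish on the ideal
    J(C, X); the first one is what a contraction needs to recover the second,
    for the forms h that are orthogonal to C but not to x. *)
Definition admissible C X Y :=
  (forall h, mult Y h <= mult X h)%N /\
  (forall h, h \in hs -> perp C h -> mult Y h < mult X h)%N.

Definition separates C X j d := exists Ys : 'I_d -> seq V,
  [/\ forall i, size (Ys i) = j, forall i, admissible C X (Ys i) &
   forall a : 'I_d -> K,
     (forall f, ker C f -> f \is j.-homog ->
        \sum_(i < d) a i * ev (Ys i) f = 0) ->
     forall i, a i = 0].

Lemma admissible_contract C X x Y :
  admissible (x :: C) X Y -> admissible C (x :: X) Y.
Proof.
move=> [le_m lt_m]; split=> [h|h hs_h Ch]; rewrite mult_cons.
  exact: leq_trans (le_m h) (leq_addl _ _).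
have [xh|xh] := eqVneq (dot x h) 0; last by rewrite add1n ltnS.
by rewrite add0n lt_m //= xh eqxx.
Qed.

Lemma admissible_delete C X x Y :
  admissible C X Y -> admissible C (x :: X) (x :: Y).
Proof.
move=> [le_m lt_m]; split=> [h|h hs_h Ch]; rewrite !mult_cons.
  by rewrite leq_add2l.
by rewrite ltn_add2l lt_m.
Qed.

Lemma admissible_loop C X x Y : admissible C X Y -> admissible C (x :: X) Y.
Proof.
move=> [le_m lt_m]; split=> [h|h hs_h Ch]; rewrite mult_cons.
  exact: leq_trans (le_m h) (leq_addl _ _).
exact: leq_trans (lt_m h hs_h Ch) (leq_addl _ _).
Qed.

Lemma separates_loop C X x j d : separates C X j d -> separates C (x :: X) j d.
Proof.
by move=> [Ys [sz adm ind]]; exists Ys; split=> // i; apply: admissible_loop.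
Qed.

Lemma separates_step0 C X x d :
  separates (x :: C) X 0 d -> separates C (x :: X) 0 d.
Proof.
move=> [Ys [sz adm ind]]; exists Ys; split=> // [i|a Ha].
  exact: admissible_contract.
by apply: ind => f /andP[_ Cf]; apply: Ha.
Qed.

(** The functionals composed with D_x vanish on W_(x :: C), so a vanishing
    combination first has zero coefficients on the functionals that come from
    the contraction; as D_x maps W_C onto W_C, the other coefficients are then
    zero as well. *)
Lemma separates_step C X x w j d1 d2 :
    perp C w -> dot x w != 0 -> (j < N)%N ->
    separates (x :: C) X j.+1 d1 -> separates C X j d2 ->
  separates C (x :: X) j.+1 (d1 + d2).
Proof.
move=> Cw xw lt_N [Y1 [sz1 adm1 ind1]] [Y2 [sz2 adm2 ind2]].
pose Ys i := match split i with inl k => Y1 k | inr k => x :: Y2 k end.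
exists Ys; rewrite /Ys; split=> [i|i|a].
- by case: (split i) => k //=; rewrite sz2.
- case: (split i) => k; first exact: admissible_contract.
  exact: admissible_delete.
have sumE f : \sum_(i < d1 + d2) a i * ev (Ys i) f
    = \sum_i a (lshift d2 i) * ev (Y1 i) f
      + \sum_i a (rshift d1 i) * ev (Y2 i) (dirD x f).
  rewrite big_split_ord /Ys; congr (_ + _); apply: eq_bigr => i _.
    by rewrite (unsplitK (inl i)).
  by rewrite (unsplitK (inr i)).
move=> Ha.
have a1 : forall i, a (lshift d2 i) = 0.
  apply: ind1 => f /andP[/eqP xf Cf] f_j; rewrite -[RHS](Ha f Cf f_j) sumE xf.
  by rewrite [X in _ + X]big1 ?addr0 // => i _; rewrite linear0 mulr0.
have a2 : forall i, a (rshift d1 i) = 0.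
  apply: ind2 => g Cg g_j.
  have [f [Cf f_j Df]] := integrate_homog Cw xw Cg g_j lt_N.
  rewrite -[RHS](Ha f Cf f_j) sumE Df.
  by rewrite [X in X + _]big1 ?add0r // => i _; rewrite a1 mul0r.
by move=> i; rewrite -(splitK i); case: (split i) => k /=.
Qed.

Lemma separates0 C X j : separates C X j 0.
Proof. by exists (fun _ => [::]); split=> [[]|[]|a _ []]. Qed.

Lemma separates_base C X j : (forall h, h \in hs -> ~~ perp C h) ->
  separates C X j (j == 0)%N.
Proof.
move=> Chs; case: j => [|j]; last exact: separates0.
exists (fun _ => [::]); split=> // [_|a Ha i].
  by split=> h // hs_h Ch; have := Chs h hs_h; rewrite Ch.
have := Ha 1; rewrite big_ord1 dhomog1 ker_homog0 ?dhomog1 // => /(_ isT isT).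
by rewrite /ev /= mcoeff1 eqxx mulr1 => <-; congr a; apply: ord1.
Qed.

(** Pairing the spanning elements with the independent functionals gives a
    square matrix.  A combination of its rows that vanishes is a combination
    of functionals that vanishes on the spanning elements and on the ideal,
    hence everywhere; so the matrix is invertible, and no nonzero combination
    of the spanning elements is killed by all the functionals. *)
Lemma spans_separates_basis X j d :
  spans [::] X j d -> separates [::] X j d ->
  exists s : 'I_d -> R,
  [/\ forall i, s i \is j.-homog,
      forall f, f \is j.-homog ->
        exists a : 'I_d -> K, power_ideal [::] X j (f - \sum_(i < d) a i *: s i)
    & forall a : 'I_d -> K,
        (forall Y, admissible [::] X Y -> ev Y (\sum_(i < d) a i *: s i) = 0) ->
        forall i, a i = 0].
Proof.
move=> [s [Hs Sp]] [Ys [sz adm ind]]; exists s; split=> [i|f f_j|a Ha].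
- by have [] := Hs i.
- exact: Sp.
pose M : 'M[K]_d := \matrix_(k, i) ev (Ys k) (s i).
have M_unit : M \in unitmx.
  rewrite -row_free_unit; apply: inj_row_free => v vM0; apply/rowP => k.
  rewrite [RHS]mxE; move: k; apply: ind => f _ f_j.
  have [b Ib] := Sp f isT f_j.
  have evI g : power_ideal [::] X j g -> forall k, ev (Ys k) g = 0.
    move=> Ig k; elim: Ig => [|h e f' g' hs_h Ch _ _ _ _ IH].
      exact: linear0.
    by rewrite raddfD /= IH addr0 ev_mulXn //; apply: (adm k).2.
  rewrite -[f](subrK (\sum_i b i *: s i)).
  under eq_bigr => k _ do rewrite raddfD /= evI // add0r ev_lincomb mulr_sumr.
  rewrite exchange_big big1 // => i _ /=.
  under eq_bigr => k _ do rewrite mulrCA.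
  rewrite -mulr_sumr; have /rowP/(_ i) := vM0; rewrite !mxE.
  by under eq_bigr => k _ do rewrite mxE; move=> ->; rewrite mulr0.
have Ma : M *m (\col_i a i) = 0.
  apply/colP => k; rewrite !mxE -[RHS](Ha _ (adm k)) ev_lincomb.
  by apply: eq_bigr => i _; rewrite !mxE mulrC.
have /colP a0 : \col_i a i = 0.
  by rewrite -(mulKmx M_unit (\col_i a i)) Ma mulmx0.
by move=> i; have := a0 i; rewrite !mxE.
Qed.

(** * The Hilbert polynomial by deletion and contraction *)

(** The coefficients of p are the dimensions of the graded pieces of
    W_C / J(C, X), in the degrees at most N only. *)
Definition hilbert_poly C X (p : {poly int}) :=
  forall j, (j <= N)%N ->
    exists d, [/\ p`_j = d%:Z, spans C X j d & separates C X j d].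

Lemma hilbert_loop C X x p : (forall h, perp C h -> dot x h = 0) ->
  hilbert_poly C X p -> hilbert_poly C (x :: X) p.
Proof.
move=> xl Hp j /Hp[d [pj Sp Se]]; exists d; split=> //; first exact: spans_loop.
exact: separates_loop.
Qed.

Lemma hilbert_step C X x w p1 p2 : perp C w -> dot x w != 0 ->
    hilbert_poly (x :: C) X p1 -> hilbert_poly C X p2 ->
  hilbert_poly C (x :: X) (p1 + 'X * p2).
Proof.
move=> Cw xw H1 H2 [|j] le_N; have [d1 [E1 Sp1 Se1]] := H1 _ le_N.
  exists d1; rewrite coefD coefXM addr0; split=> //; first exact: spans_step0.
  exact: separates_step0.
have [d2 [E2 Sp2 Se2]] := H2 _ (ltnW le_N).
exists (d1 + d2)%N; rewrite coefD coefXM E1 E2; split=> //.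
  exact: spans_step Cw xw le_N Sp1 Sp2.
exact: separates_step Cw xw le_N Se1 Se2.
Qed.

Lemma hilbert_base C X : (forall h, h \in hs -> ~~ perp C h) ->
    (forall i f, ker C f -> f^`M(i) = 0) -> hilbert_poly C X 1.
Proof.
move=> Chs Cfull j le_N; exists (j == 0)%N; rewrite coef1; split.
- by case: (j).
- exact: spans_base.
exact: separates_base.
Qed.

Lemma hilbert_deficient C X h : h \in hs -> perp C h -> perp X h ->
  hilbert_poly C X 0.
Proof.
move=> hs_h Ch Xh j _; exists 0%N; rewrite coef0; split=> //.
  exact: spans_deficient hs_h Ch Xh.
exact: separates0.
Qed.

Lemma hilbert_loops C X x m p : (forall h, perp C h -> dot x h = 0) ->
  hilbert_poly C X p -> hilbert_poly C (nseq m x ++ X) p.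
Proof. by move=> xl Hp; elim: m => //= m IH; apply: hilbert_loop. Qed.

(** Contracting one of m parallel vectors turns the remaining ones into loops,
    so only the number of copies deleted before that matters. *)
Lemma hilbert_steps C X x w m p1 p2 : perp C w -> dot x w != 0 ->
    hilbert_poly (x :: C) X p1 -> hilbert_poly C X p2 ->
  hilbert_poly C (nseq m x ++ X) ((\sum_(i < m) 'X^i) * p1 + 'X^m * p2).
Proof.
move=> Cw xw H1 H2; elim: m => [|m IH] /=.
  by rewrite big_ord0 mul0r add0r expr0 mul1r.
have -> : (\sum_(i < m.+1) 'X^i) * p1 + 'X^(m.+1) * p2
   = p1 + 'X * ((\sum_(i < m) 'X^i) * p1 + 'X^m * p2).
  rewrite big_ord_recl expr0 mulrDl mul1r mulrDr -addrA !mulrA -exprS.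
  rewrite mulr_sumr; congr (_ + (_ * _ + _)); apply: eq_bigr => i _.
  by rewrite -exprS.
apply: (hilbert_step Cw xw) => //; apply: hilbert_loops => // h /andP[/eqP xh _].
exact: xh.
Qed.

End DeletionContraction.

(** * From the Hilbert polynomial to the Hilbert series *)

Section HilbertSeries.
Variables (K : fieldType) (n : nat) (N : nat).

Lemma mem_ideal (gs : seq {mpoly K[n]}) g : g \in gs -> g \in ideal gs.
Proof.
move=> gs_g; apply/idealP; exists (fun i => (i == index g gs)%:R).
have lt_i : (index g gs < size gs)%N by rewrite index_mem.
rewrite (bigD1 (Ordinal lt_i)) //= eqxx mul1r nth_index // big1 ?addr0 // => i.
by rewrite -val_eqE /= => /negbTE->; rewrite mul0r.
Qed.

Lemma ideal_homogS (gs : seq {mpoly K[n]}) j :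
    (forall f, f \is j.-homog -> f \in ideal gs) ->
  forall f, f \is j.+1.-homog -> f \in ideal gs.
Proof.
move=> Ij f /dhomogP f_j; rewrite (mpolyE f) big_seq rpred_sum // => m m_f.
have /= m_j := f_j m m_f; have [i mi] := mdegS_gt0 m_j.
have le_m : (U_(i) <= m)%MM by rewrite lep1mP -lt0n.
rewrite idealZ // -(submK le_m) addmC mpolyXD idealMl // Ij // dhomogX /=.
by rewrite -eqSS -m_j -[in eqbRHS](submK le_m) mdegD mdeg1 addn1.
Qed.

Variables (hs X : seq 'rV[K]_n).
Let gs := [seq linf h ^+ mult X h | h <- hs].

Lemma power_ideal_sub j f : power_ideal hs [::] X j f -> f \in ideal gs.
Proof.
elim=> [|h e f' g hs_h _ _ _ _ _ IH]; first exact: rpred0.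
by rewrite rpredD // idealMl // mem_ideal //; apply: map_f.
Qed.

Lemma ev_ideal Y f : admissible hs [::] X Y -> f \in ideal gs -> ev Y f = 0.
Proof.
move=> [_ lt_m] /idealP[c ->]; rewrite linear_sum big1 // => i _ /=.
have lt_i : (i < size hs)%N by rewrite -(size_map (fun h => linf h ^+ mult X h)).
by rewrite (nth_map 0) // ev_mulXn // lt_m // mem_nth.
Qed.

(** A Hilbert polynomial of degree less than N shows that the ideal contains
    all forms of degree N, hence all forms of larger degree. *)
Lemma hilbert_poly_series (p : {poly int}) : (size p <= N)%N ->
  hilbert_poly N hs [::] X p -> is_hilbert_series gs (fun j => p`_j).
Proof.
move=> sz_p Hp.
have IN f j : f \is (N + j).-homog -> f \in ideal gs.
  elim: j f => [|j IH] f; last by rewrite addnS; apply: ideal_homogS.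
  rewrite addn0 => f_N; have [d []] := Hp _ (leqnn N).
  rewrite nth_default // => /esym/eqP; rewrite eqz_nat => /eqP-> [s [_ Sp]] _.
  by have [a] := Sp f isT f_N; rewrite big_ord0 subr0; apply: power_ideal_sub.
move=> j; have [lt_j|le_j] := ltnP N j.
  exists 0%N; last by rewrite nth_default // (leq_trans sz_p) // ltnW.
  exists (fun _ => 0); split=> [[]|a _ []|x [f f_j ->]] //.
  exists (fun _ => 0); rewrite big_ord0 -(raddf0 (mproj gs)).
  by apply/mprojP; rewrite subr0 (IN f (j - N)%N) // subnKC // ltnW.
have [d [pj Sp Se]] := Hp j le_j; exists d => //.
have [s [Hs s_span s_free]] := spans_separates_basis Sp Se.
have mprojE (a : 'I_d -> K) :
    \sum_i a i *: mproj gs (s i) = mproj gs (\sum_i a i *: s i).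
  by rewrite raddf_sum; apply: eq_bigr => i _; rewrite /= -linearZ.
exists (fun i => mproj gs (s i)); split=> [i|a|x [f f_j ->]].
- by exists (s i).
- rewrite mprojE -(raddf0 (mproj gs)) => /mprojP; rewrite subr0 => Ia.
  by apply: s_free => Y adm_Y; apply: ev_ideal.
have [a Ia] := s_span f f_j; exists a; rewrite mprojE; apply/mprojP.
exact: power_ideal_sub Ia.
Qed.

End HilbertSeries.

(** * Cuts of the complete graph on four vertices *)

Section CompleteGraph.
Variable K : fieldType.

(** Vertex u > 0 corresponds to coordinate u - 1, and the root 0 to the zero
    vector. *)
Definition edge (u v : nat) : 'rV[K]_3 :=
  \row_(i < 3) ((i.+1 == u)%:R - (i.+1 == v)%:R).
Definition indic (S : seq nat) : 'rV[K]_3 := \row_(i < 3) (i.+1 \in S)%:R.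

(** A form h, read as a function on the vertices with value 0 at the root;
    being orthogonal to an edge means taking the same value at both ends. *)
Definition potential (h : 'rV[K]_3) (u : nat) : K :=
  \sum_(i < 3) (i.+1 == u)%:R * h 0 i.
Definition vertex_deriv (f : {mpoly K[3]}) (u : nat) :=
  \sum_(i < 3) (i.+1 == u)%:R *: f^`M(i).

Lemma dot_edge u v h : dot (edge u v) h = potential h u - potential h v.
Proof. by rewrite -sumrB; apply: eq_bigr => i _; rewrite mxE mulrBl. Qed.

Lemma dirD_edge u v f :
  dirD (edge u v) f = vertex_deriv f u - vertex_deriv f v.
Proof. by rewrite -sumrB; apply: eq_bigr => i _; rewrite mxE scalerBl. Qed.

Lemma potential0 h : potential h 0 = 0.
Proof. by rewrite /potential big1 // => i _; rewrite mul0r. Qed.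

Lemma vertex_deriv0 f : vertex_deriv f 0 = 0.
Proof. by rewrite /vertex_deriv big1 // => i _; rewrite scale0r. Qed.

Lemma vertex_derivS f (i : 'I_3) : vertex_deriv f i.+1 = f^`M(i).
Proof.
rewrite /vertex_deriv (bigD1 i) //= eqxx scale1r big1 ?addr0 // => j.
by rewrite eqSS -val_eqE => /negbTE->; rewrite scale0r.
Qed.

Lemma potential_indic S u :
  potential (indic S) u = ((0 < u < 4)%N && (u \in S))%:R.
Proof.
rewrite /potential !big_ord_recl big_ord0 !mxE /= /bump /=.
by case: u => [|[|[|[|u]]]] /=; rewrite ?mul0r ?mul1r ?add0r ?addr0.
Qed.

Lemma dot_edge_indic u v S : (dot (edge u v) (indic S) == 0) =
  (((0 < u < 4) && (u \in S)) == ((0 < v < 4) && (v \in S)))%N.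
Proof.
rewrite dot_edge !potential_indic subr_eq0.
by do 2!case: (_ && _); rewrite ?eqxx ?oner_eq0 // eq_sym oner_eq0.
Qed.

Definition cut_forms := map indic
  [:: [:: 1]; [:: 2]; [:: 3]; [:: 1; 2]; [:: 1; 3]; [:: 2; 3]; [:: 1; 2; 3]]%N.

Definition K4 k l :=
  nseq l (edge 3 0) ++ nseq k (edge 1 3) ++ nseq k (edge 2 3)
  ++ nseq l (edge 1 0) ++ nseq l (edge 2 0) ++ nseq k (edge 1 2) ++ [::].

Lemma linf_indic S : linf (indic S) = (1%N \in S)%:R *: 'X_(inord 0)
  + (2 \in S)%:R *: 'X_(inord 1) + (3 \in S)%:R *: 'X_(inord 2).
Proof.
rewrite /linf !big_ord_recl big_ord0 addr0 addrA !mxE.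
by do !congr (_ + _); congr (_ *: 'X_ _); apply: val_inj; rewrite /= inordK.
Qed.

(** The exponents of the generators of J_phi are the sizes of the cuts. *)
Lemma J_gens_cuts (phi : nat -> nat) k l :
    (forall r, (1 <= r <= 3)%N -> phi r = (l + k * (3 - r))%N) ->
  [seq linf h ^+ mult (K4 k l) h | h <- cut_forms] = J_gens K phi.
Proof.
move=> phiE; rewrite /J_gens !phiE //=.
rewrite /mult /K4 !count_cat !count_nseq !dot_edge_indic !linf_indic /=.
rewrite !scale1r !scale0r ?addr0 ?add0r.
by do !congr (_ :: _); congr (_ ^+ _); lia.
Qed.

Variable N : nat.
Hypothesis N_unit : forall i, (0 < i <= N)%N -> i%:R != 0 :> K.

(* Orthogonality to a set of edges is a set of equations between values at the
   vertices, so membership in a span is decided by congruence closure. *)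
Ltac by_potentials :=
  rewrite ?subr_eq0 ?potential0 ?vertex_deriv0;
  repeat (case/andP => /eqP; let E := fresh "E" in intro E);
  let E := fresh "E" in intro E; clear E; congruence.

Ltac first_cut tac := first
  [ tac [:: 1]%N | tac [:: 2]%N | tac [:: 3]%N | tac [:: 1; 2]%N
  | tac [:: 1; 3]%N | tac [:: 2; 3]%N | tac [:: 1; 2; 3]%N ].

(* An edge either is separated from the contracted ones by some cut, or is a
   loop. *)
Ltac step_cut S := apply: (@hilbert_steps _ _ _ _ N_unit _ _ _ (indic S));
  [ rewrite /perp /= ?dot_edge_indic; reflexivity
  | rewrite dot_edge_indic; reflexivity | | ].
Ltac step_loop := apply: hilbert_loops;
  [ let h := fresh "h" in let H := fresh "H" in
    intros h H; apply/eqP; rewrite dot_edge subr_eq0; apply/eqP; move: H;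
    rewrite /perp /= !dot_edge; by_potentials |].
Ltac step := first [ first_cut step_cut | step_loop ]; simpl cat.

(* Without edges left, the contracted ones either form a spanning tree or miss
   some cut. *)
Ltac leaf_cut S := apply: (@hilbert_deficient _ _ _ _ _ _ (indic S));
  [ apply: map_f; reflexivity
  | rewrite /perp /= ?dot_edge_indic; reflexivity | reflexivity ].
Ltac leaf_tree := apply: (hilbert_base N_unit);
  [ apply/allP; rewrite /perp /= !dot_edge_indic; reflexivity
  | let i := fresh "i" in let f := fresh "f" in
    intros i f; rewrite /ker /= !dirD_edge -vertex_derivS;
    case: i => [[|[|[|]]] //= _]; by_potentials ].
Ltac leaf := first [ leaf_tree | first_cut leaf_cut ].

(** The left-hand side is (1 - t)^3 times the result of the recursion on
    [K4 k l], where y = 1 - t, while A and B are the sums of the t^i for i < k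
    and i < l, so that a = t^k and b = t^l. *)
Lemma K4_identity (R : comPzRingType) (A B y : R) :
  let a := 1 - A * y in let b := 1 - B * y in
  let T := A * (B * (B + b * A) + b * (B * A)) in
  let U := A * (B + b * A) + a * (B * (B + b * A) + b * (B * A)) in
  (B * (A * (A + a * (B + b * A)) + a * U)
   + b * (A * (A * (B + b * B) + a * (B * (B + b * A) + b * (B * A))) + a * T))
  * y ^+ 3 =
  1 - 3 * (b * a ^+ 2) - 3 * (b * a) ^+ 2 - b ^+ 3
  + 6 * (b * a ^+ 2 * (b * a)) + 6 * (b * a * (b * a) * b)
  - 6 * (b * a ^+ 2 * (b * a) * b).
Proof. by rewrite /=; ring. Qed.

Lemma cut_ideal_hilbert k l (phi : nat -> nat) :
    (forall r, (1 <= r <= 3)%N -> phi r = (l + k * (3 - r))%N) ->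
  exists2 p, hilbert_poly N cut_forms [::] (K4 k l) p &
    p * (1 - 'X) ^+ 3 =
      1 - 3 *: 'X^(phi 1%N) - 3 *: 'X^(2 * phi 2%N) - 'X^(3 * phi 3%N)
       + 6 *: 'X^(phi 1%N + phi 2%N) + 6 *: 'X^(2 * phi 2%N + phi 3%N)
       - 6 *: 'X^(phi 1%N + phi 2%N + phi 3%N).
Proof.
(* The polynomial is produced by unification along the recursion. *)
move=> phiE; eexists; first by rewrite /K4; repeat step; leaf.
rewrite !phiE //=.
have XnE m : 'X^m = 1 - (\sum_(i < m) 'X^i) * (1 - 'X) :> {poly int}.
  by rewrite -(opprB 'X 1) mulrN opprK mulrC -subrX1 addrC subrK.
have XM2 m : 'X^(2 * m) = 'X^m ^+ 2 :> {poly int} by rewrite mulnC exprM.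
have XM3 m : 'X^(3 * m) = 'X^m ^+ 3 :> {poly int} by rewrite mulnC exprM.
rewrite !subSS !subn0 muln0 addn0 muln1 XM2 XM3 !exprD !(mulnC k 2) !XM2.
rewrite -!mul_polyC !rmorph_nat (XnE k) (XnE l).
rewrite expr0 !(mulr0, mulr1, addr0).
exact: K4_identity.
Qed.

End CompleteGraph.

(** * The Hilbert series *)

Lemma natr_neq0_pchar (K : fieldType) N :
    [pchar K] =i pred0 \/ (exists2 p, p \in [pchar K] & (N < p)%N) ->
  forall i, (0 < i <= N)%N -> i%:R != 0 :> K.
Proof.
move=> hchar i /andP[i_gt0 le_iN]; apply/negP => /eqP i0.
case: hchar => [char0|[p charp lt_Np]].
  have [|q] := natf0_pchar i_gt0 (_ : i%:R == 0 :> K); first exact/eqP.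
  by rewrite char0.
have : (p %| i)%N by rewrite (dvdn_pcharf charp) i0.
by move=> /(dvdn_leq i_gt0); rewrite leqNgt (leq_ltn_trans le_iN).
Qed.

Theorem corollary4p5 (K : fieldType) (phi : nat -> nat)
    (hphi : linear_degree_function phi)
    (hchar : [pchar K] =i pred0 \/
       exists2 p : nat, p \in [pchar K] & (phi 1 + phi 2 + phi 3 - 2 < p)%N) :
  exists P : fps,
    is_hilbert_series (J_gens K phi) P /\
    fps_is_fraction P
      (1 - 3 *: 'X^(phi 1%N) - 3 *: 'X^(2 * phi 2%N) - 'X^(3 * phi 3%N)
       + 6 *: 'X^(phi 1%N + phi 2%N) + 6 *: 'X^(2 * phi 2%N + phi 3%N)
       - 6 *: 'X^(phi 1%N + phi 2%N + phi 3%N))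
      ((1 - 'X) ^+ 3).
Proof.
have [k [l [k_gt0 l_gt0 phiE]]] := hphi.
set N := (phi 1 + phi 2 + phi 3 - 2)%N in hchar *.
have N_unit := natr_neq0_pchar hchar.
have [p Hp pE] := cut_ideal_hilbert N_unit phiE.
exists (fun j => p`_j); split.
  rewrite -(J_gens_cuts K phiE); apply: (hilbert_poly_series _ Hp).
  have [->|p_nz] := eqVneq p 0; first by rewrite size_poly0.
  have sz3 : size ((1 - 'X) ^+ 3 : {poly int}) = 4%N.
    by rewrite -(opprB 'X 1) exprNn -signr_odd mulN1r size_polyN size_exp_XsubC.
  have nz3 : (1 - 'X) ^+ 3 != 0 :> {poly int} by rewrite -size_poly_gt0 sz3.
  have := size_mul p_nz nz3; rewrite sz3 pE => szN.
  (* The numerator has degree N + 2 at most, and the denominator degree 3. *)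
  suff : (size p + 3 <= N + 3)%N by rewrite leq_add2r.
  have -> : (size p + 3 = (size p + 4).-1)%N by lia.
  rewrite -szN; set m := (N + 3)%N.
  have szX c e : (e < m)%N -> (size (c *: 'X^e : {poly int}) <= m)%N.
    by move=> lt_e; rewrite (leq_trans (size_scale_leq _ _)) // size_polyXn.
  have szD (u v : {poly int}) :
      (size u <= m -> size v <= m -> size (u + v)%R <= m)%N.
    by move=> Hu Hv; rewrite (leq_trans (size_polyD _ _)) // geq_max Hu.
  rewrite -[X in _ - X + _](scale1r ('X^(3 * phi 3%N))).
  do ![rewrite size_polyN | apply: (szX) | apply: (szD)];
    rewrite ?size_poly1 /m /N !phiE //=; lia.
split; first by rewrite -horner_coef0 !hornerE.
by move=> m; rewrite -pE /fps_mul /fps_of_poly coefM.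
Qed.
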